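(* Let $\mu^-<\mu^+$, $\Lambda=(\mu^-,\mu^+)$, $P\in\mathcal P_\mu$. Assume that $$\lim_{x\to+\infty}\vartheta(x,\mu^+)=\theta^+\in\mathbb R.$$ Then $\displaystyle\lim_{\lambda\to(\mu^+)^-}\nu(\lambda)<+\infty$.
   Context: $M^2_S$ is the set of real symmetric $2\times2$ matrices and $J=\begin{pmatrix}0&1\\-1&0\end{pmatrix}$. Class $\mathcal P_\mu$: continuous maps $P:(0,+\infty)\to M^2_S$ such that (i) there is $q_\infty\ge1$ with $\lim_{x\to+\infty}P(x)=P_\infty:=\mathrm{diag}(\mu^-,\mu^+)$ and $\int_1^{+\infty}\|P(x)-P_\infty\|^{q_\infty}dx<+\infty$; (ii) there are $\beta\ge1$, $P^*\in M^2_S$, $q_0\ge1$ with $\lim_{x\to0^+}x^\beta P(x)=P^*$ and $\int_0^1x^{-\beta}\|x^\beta P(x)-P^*\|^{q_0}dx<+\infty$; (iii) $\det P^*<-1/4$ if $\beta=1$, and $\det P^*<0$ if $\beta>1$. For $\lambda\in(\mu^-,\mu^+]$ let $\zeta_{1,\lambda}$ be the nontrivial solution (unique up to a constant factor) of $Jz'+P(x)z=\lambda z$, $x>0$, with $\zeta_{1,\lambda}(x)\to0$ as $x\to0^+$. Its continuous angular coordinate $\vartheta(\cdot,\lambda)$ (components $\rho\cos\vartheta$, $\rho\sin\vartheta$) has a finite limit at $0^+$, which mod $\pi$ does not depend on $\lambda$, and is normalized so that this limit lies in $[0,\pi)$. For $\lambda\in\Lambda$, the limit $\nu(\lambda)=\lim_{x\to+\infty}\vartheta(x,\lambda)$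 exists and is finite. *)

(* Defs.v *)
From mathcomp Require Import all_boot all_order all_algebra.
From mathcomp Require Import all_classical all_reals all_analysis.
Import Order.TTheory GRing.Theory Num.Theory.
Import numFieldNormedType.Exports.

Set Implicit Arguments.
Unset Strict Implicit.
Unset Printing Implicit Defensive.

Local Open Scope classical_set_scope.
Local Open Scope ring_scope.

Definition symplJ (R : realType) : 'M[R]_2 := delta_mx 0 1 - delta_mx 1 0.

Definition Pinf (R : realType) (mum mup : R) : 'M[R]_2 :=
  diag_mx (\row_(j < 2) [:: mum; mup]`_j).

Definition cond_infty (R : realType) (mum mup : R) (P : R -> 'M[R]_2) : Prop :=
  exists q : R,
    [/\ 1 <= q,
        P x @[x --> +oo] --> Pinf mum mup &
        (\int[lebesgue_measure]_(x in `[1%R, +oo[)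
           (`|P x - Pinf mum mup| `^ q)%:E < +oo)%E].

Definition cond_zero (R : realType) (P : R -> 'M[R]_2) : Prop :=
  exists (beta : R) (Pstar : 'M[R]_2) (q : R),
    [/\ [/\ 1 <= beta, Pstar^T = Pstar & 1 <= q],
        x `^ beta *: P x @[x --> 0^'+] --> Pstar,
        (\int[lebesgue_measure]_(x in `]0%R, 1%R])
           (x `^ (- beta) * `|x `^ beta *: P x - Pstar| `^ q)%:E < +oo)%E,
        (beta = 1 -> \det Pstar < - (1 / 4)) &
        (1 < beta -> \det Pstar < 0)].

(* The norm on ['M_2] is the library's max norm.  All norms on [M_2] being
   equivalent, the two integrability conditions do not depend on this choice.
   [P] is total, but only its values on (0, +oo) are constrained. *)
Definition classP (R : realType) (mum mup : R) (P : R -> 'M[R]_2) : Prop :=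
  [/\ {in `]0, +oo[%R, continuous P},
      (forall x : R, 0 < x -> (P x)^T = P x),
      cond_infty mum mup P &
      cond_zero P].

Definition is_solution (R : realType) (P : R -> 'M[R]_2) (lambda : R)
    (z : R -> 'cV[R]_2) : Prop :=
  forall x : R, 0 < x ->
    derivable z x 1 /\
    symplJ R *m (z^`()%classic) x + P x *m z x = lambda *: z x.

Definition is_zeta1 (R : realType) (P : R -> 'M[R]_2) (lambda : R)
    (z : R -> 'cV[R]_2) : Prop :=
  [/\ is_solution P lambda z,
      (exists2 x : R, 0 < x & z x != 0) &
      z x @[x --> 0^'+] --> (0 : 'cV[R]_2)].

Definition is_angle (R : realType) (z : R -> 'cV[R]_2) (th : R -> R) : Prop :=
  {in `]0, +oo[%R, continuous th} /\
  exists rho : R -> R, forall x : R, 0 < x ->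
    [/\ 0 < rho x,
        z x 0 0 = rho x * cos (th x) &
        z x 1 0 = rho x * sin (th x)].

(* The solution is unique only up to a nonzero factor, whose sign shifts the
   angle by pi; requiring the limit at 0 to be in [0, pi) fixes [th]. *)
Definition is_theta (R : realType) (P : R -> 'M[R]_2) (lambda : R)
    (th : R -> R) : Prop :=
  (exists2 z : R -> 'cV[R]_2, is_zeta1 P lambda z & is_angle z th) /\
  (exists2 th0 : R, 0 <= th0 < pi & th x @[x --> 0^'+] --> th0).

(* Main.v *)
(* For solutions z1, z2 with lam1 < lam2, the Wronskian W = u1 v2 - v1 u2
   satisfies W' = (lam2 - lam1) <z1, z2>, i.e. in polar coordinates
   W = rho1 rho2 sin (th2 - th1) and W' = (lam2 - lam1) rho1 rho2 cos (th2 - th1).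
   At 0 the angle of a decaying solution converges to a null direction e of P^*,
   and the decay forces <P^* e, e^perp> > 0; as P^* is indefinite only one null
   line has this property, so all normalized angles share the same limit at 0.
   Since W -> 0 at 0, this gives th1 < th2 near 0, and the sign of W' at a zero
   of th2 - th1 propagates the inequality to (0, +oo).  Hence nu is nondecreasing
   and bounded above by the limit of theta (., mu^+). *)

Require Import Defs.
From mathcomp Require Import all_boot all_order all_algebra.
From mathcomp Require Import all_classical all_reals all_analysis.
From mathcomp Require Import ring lra.
Import Order.TTheory GRing.Theory Num.Theory.
Import numFieldNormedType.Exports.

Set Implicit Arguments.
Unset Strict Implicit.

Local Open Scope classical_set_scope.
Local Open Scope ring_scope.

(** * Calculus at the right of 0 *)

Lemma at_right0_itv (R : realType) (Q : R -> Prop) :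
  (\forall x \near 0^'+, Q x) ->
  exists2 e : R, 0 < e & forall x, 0 < x < e -> Q x.
Proof.
case=> e /= e0 He; exists e => // x /andP[x0 xe].
by apply: He => //=; rewrite sub0r normrN gtr0_norm.
Qed.

Lemma is_derive_gt0_lt (R : realType) (f g : R -> R) (a b x y : R) :
  (forall t, a < t < b -> is_derive t 1 f (g t) /\ 0 < g t) ->
  a < x -> x < y -> y < b -> f x < f y.
Proof.
move=> fg ax xy yb; apply: (@gtr0_derive1_lt_oo _ f a b) => //.
- by move=> t; rewrite in_itv/= => /fg[[]].
- by move=> t; rewrite in_itv/= => /fg[df g0]; rewrite derive1E derive_val.
- move=> t; rewrite inE/= in_itv/= => /fg[[df _] _].
  exact/differentiable_continuous/derivable1_diffP.
- by rewrite in_itv/= ax (lt_trans xy).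
- by rewrite in_itv/= yb andbT (lt_trans ax).
Qed.

Lemma is_derive_gt0_cvg0_gt0 (R : realType) (f g : R -> R) (b x : R) :
  (forall t, 0 < t < b -> is_derive t 1 f (g t) /\ 0 < g t) ->
  f t @[t --> 0^'+] --> 0 -> 0 < x < b -> 0 < f x.
Proof.
move=> fg f0 /andP[x0 xb]; rewrite ltNge; apply/negP => fx.
(* Moving from [x] to [x / 2] makes the inequality strict: [f (x / 2)] is negative and bounds [f]
   from above on its left, so [f] cannot tend to 0. *)
have x20 : 0 < x / 2 by lra.
have fx2 : f (x / 2) < 0.
  by apply: lt_le_trans fx; apply: (is_derive_gt0_lt fg) => //; lra.
have near_gt : \forall t \near 0^'+, f (x / 2) < f t by exact: cvgr_gt f0 _ fx2.
near (0:R)^'+ => t.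
have ft : f (x / 2) < f t by near: t; exact: near_gt.
have t0 : 0 < t by near: t; exact: nbhs_right_gt.
have tx : t < x / 2 by near: t; exact: nbhs_right_lt.
have x2b : x / 2 < b by lra.
by have := is_derive_gt0_lt fg t0 tx x2b; rewrite ltNge (ltW ft).
Unshelve. all: by end_near. Qed.

(* Since [beta >= 1], [x `^ (- beta)] dominates [1 / x], so a positive limit
   would force [f x] to [-oo] at least as fast as [ln x]. *)
Lemma cvg_at_right0_deriv_le0 (R : realType) (f g : R -> R) (beta l L e : R) :
  1 <= beta -> 0 < e ->
  (forall x, 0 < x < e -> is_derive x 1 f (g x)) ->
  f x @[x --> 0^'+] --> l -> x `^ beta * g x @[x --> 0^'+] --> L -> L <= 0.
Proof.
move=> beta1 e0 df fl gL; rewrite leNgt; apply/negP => L0.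
pose k := L / 2; have k0 : 0 < k by rewrite /k; lra.
have kL : k < L by rewrite /k; lra.
have near_g : \forall x \near 0^'+, k < x `^ beta * g x by exact: cvgr_gt gL _ kL.
have [d d0 dP] : exists2 d, 0 < d & forall x, 0 < x < d ->
    [/\ x < e, x < 1 & k < x `^ beta * g x].
  apply: at_right0_itv; near=> x; split; near: x;
    [exact: nbhs_right_lt|exact: nbhs_right_lt|exact: near_g].
(* On [(0, d)], [k < x ^ beta * g x <= x * g x], so [F] is increasing and [f] stays below
   [M + k * ln x] to the left of [d / 2]. *)
pose F x := f x - k * ln x.
have dF x : 0 < x < d -> is_derive x 1 F (g x - k * x^-1) /\ 0 < g x - k * x^-1.
  move=> /[dup] /andP[x0 _] /dP[xe x1 kg]; split.
    have := df x; rewrite x0 xe => /(_ isT) dfx.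
    have dlnx := is_derive1_ln x0.
    have -> : F = f - k \*: @ln R by apply/funext.
    exact: is_deriveB.
  rewrite subr_gt0 ltr_pdivrMr //; apply: (lt_le_trans kg).
  have gx : 0 <= g x.
    rewrite -(pmulr_rge0 _ (powR_gt0 beta x0)); apply: ltW.
    exact: lt_trans kg.
  rewrite mulrC ler_wpM2l//.
  by rewrite ge1r_powR// x0 ltW.
have d20 : 0 < d / 2 by lra.
pose M := F (d / 2).
(* Below this threshold [M + k * ln x < l - 1], whereas [f] exceeds [l - 1] near 0. *)
have small : 0 < expR ((l - 1 - M) / k) by exact: expR_gt0.
have near_f : \forall x \near 0^'+, l - 1 < f x by apply: cvgr_gt fl _ _; lra.
near (0:R)^'+ => x.
have fx : l - 1 < f x by near: x; exact: near_f.
have x0 : 0 < x by near: x; exact: nbhs_right_gt.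
have xd : x < d / 2 by near: x; exact: nbhs_right_lt.
have xs : x < expR ((l - 1 - M) / k) by near: x; exact: nbhs_right_lt.
have d2d : d / 2 < d by lra.
have := is_derive_gt0_lt dF x0 xd d2d; rewrite -/M /F => FM.
have : ln x < (l - 1 - M) / k by rewrite -ltr_expR lnK.
rewrite ltr_pdivlMr//; lra.
Unshelve. all: by end_near. Qed.

Lemma cvg_at_right0_deriv_eq0 (R : realType) (f g : R -> R) (beta l L e : R) :
  1 <= beta -> 0 < e ->
  (forall x, 0 < x < e -> is_derive x 1 f (g x)) ->
  f x @[x --> 0^'+] --> l -> x `^ beta * g x @[x --> 0^'+] --> L -> L = 0.
Proof.
move=> beta1 e0 df fl gL; apply/eqP; rewrite eq_le.
rewrite (cvg_at_right0_deriv_le0 beta1 e0 df fl gL)//= -oppr_le0.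
apply: (@cvg_at_right0_deriv_le0 _ (- f) (- g) beta (- l) _ _ beta1 e0).
- by move=> x /df ?; exact: is_deriveN.
- exact: cvgN.
- have -> : (fun x => x `^ beta * (- g) x) = - (fun x => x `^ beta * g x).
    by apply/funext => x; rewrite /= mulrN.
  exact: cvgN.
Qed.

(** * The equation in coordinates *)

Lemma is_solution_derive (R : realType) (P : R -> 'M[R]_2) (lambda : R)
    (z : R -> 'cV[R]_2) (x : R) :
  is_solution P lambda z -> 0 < x -> (P x)^T = P x ->
  is_derive x 1 (fun t => z t 0 0)
    (P x 0 1 * z x 0 0 + (P x 1 1 - lambda) * z x 1 0) /\
  is_derive x 1 (fun t => z t 1 0)
    ((lambda - P x 0 0) * z x 0 0 - P x 0 1 * z x 1 0).
Proof.
move=> sol x0 Psym; have [dz] := sol x x0.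
have P10 : P x 1 0 = P x 0 1 by rewrite -{1}Psym mxE.
have dzi i : derivable (fun t => z t i 0) x 1 by move/derivable_mxP : dz.
rewrite derive1E derive_mx// => /matrixP eqz.
have := eqz 0 0; have := eqz 1 0; rewrite /symplJ.
rewrite !mxE !big_ord_recl !big_ord0 !mxE /=.
have -> : ord0 = 0 :> 'I_2 by apply/val_inj.
have -> : lift ord0 ord0 = 1 :> 'I_2 by apply/val_inj.
rewrite P10 => eq1 eq0; split; apply: DeriveDef => //; lra.
Qed.


(** * Symmetric forms on unit vectors *)

Section QuadraticForm.
Variable R : realType.
Implicit Types a b c t : R.

(* For [M = [[a, b], [b, c]]] and [e t = (cos t, sin t)], these are
   [<M e(t), e(t)>] and [<M e(t), e(t + pi/2)>]. *)
Definition qform a b c t :=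
  a * cos t ^+ 2 + 2 * b * cos t * sin t + c * sin t ^+ 2.
Definition qskew a b c t :=
  b * (cos t ^+ 2 - sin t ^+ 2) + (c - a) * (cos t * sin t).

(** In the orthonormal basis [e t], [e (t + pi/2)] the matrix has diagonal entries [qform] and [q']
    and off-diagonal entry [qskew]; its determinant is that of the original matrix. *)
Lemma qskew_sqr_null a b c t :
  qform a b c t = 0 -> qskew a b c t ^+ 2 = b ^+ 2 - a * c.
Proof.
move=> q0; set q' := a * sin t ^+ 2 - 2 * b * cos t * sin t + c * cos t ^+ 2.
transitivity ((b ^+ 2 - a * c) * (cos t ^+ 2 + sin t ^+ 2) ^+ 2
  + qform a b c t * q').
  by rewrite /qskew /qform /q'; ring.
by rewrite q0 cos2Dsin2; ring.
Qed.

(* Both sides compute [<M e(s), e(t)>], by symmetry of [M]. *)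
Lemma qskew_null_sin a b c s t :
  qform a b c s = 0 -> qform a b c t = 0 ->
  (qskew a b c s + qskew a b c t) * sin (t - s) = 0.
Proof.
move=> qs qt.
transitivity (((cos s ^+ 2 + sin s ^+ 2) - (cos t ^+ 2 + sin t ^+ 2)) *
    (a * cos s * cos t + b * (cos s * sin t + sin s * cos t)
       + c * sin s * sin t)
  + (qform a b c t - qform a b c s) * cos (t - s)).
  by rewrite /qskew /qform sinB cosB; ring.
by rewrite qs qt !cos2Dsin2; ring.
Qed.

Lemma qformZ k a b c t : qform (k * a) (k * b) (k * c) t = k * qform a b c t.
Proof. by rewrite /qform; ring. Qed.

Lemma qskewZ k a b c t : qskew (k * a) (k * b) (k * c) t = k * qskew a b c t.
Proof. by rewrite /qskew; ring. Qed.

Variables (T : Type) (F : set_system T) (FF : Filter F).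
Variables (a b c t : T -> R) (a0 b0 c0 t0 : R).
Hypotheses (fa : a x @[x --> F] --> a0) (fb : b x @[x --> F] --> b0).
Hypotheses (fc : c x @[x --> F] --> c0) (ft : t x @[x --> F] --> t0).

Lemma cvg_qform : qform (a x) (b x) (c x) (t x) @[x --> F] --> qform a0 b0 c0 t0.
Proof.
have fcos : cos (t x) @[x --> F] --> cos t0.
  by apply: continuous_cvg ft; exact: continuous_cos.
have fsin : sin (t x) @[x --> F] --> sin t0.
  by apply: continuous_cvg ft; exact: continuous_sin.
rewrite /qform; under eq_fun do rewrite !expr2; rewrite !expr2.
apply: cvgD; [apply: cvgD|]; do ?[apply: cvgM|exact: cvg_cst|by []].
Qed.

Lemma cvg_qskew : qskew (a x) (b x) (c x) (t x) @[x --> F] --> qskew a0 b0 c0 t0.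
Proof.
have fcos : cos (t x) @[x --> F] --> cos t0.
  by apply: continuous_cvg ft; exact: continuous_cos.
have fsin : sin (t x) @[x --> F] --> sin t0.
  by apply: continuous_cvg ft; exact: continuous_sin.
rewrite /qskew; under eq_fun do rewrite !expr2; rewrite !expr2.
apply: cvgD; apply: cvgM; do ?[apply: cvgB|apply: cvgM|by []].
Qed.

End QuadraticForm.

(** * Planar systems in polar coordinates *)

Section PlanarSystem.
Variable R : realType.
Implicit Types (p q r u v rho th : R -> R) (lam : R).

Definition planar_solution p q r lam u v := forall x : R, 0 < x ->
  is_derive x 1 u (q x * u x + (r x - lam) * v x) /\
  is_derive x 1 v ((lam - p x) * u x - q x * v x).

Definition polar u v rho th := forall x : R, 0 < x ->
  [/\ 0 < rho x, u x = rho x * cos (th x) & v x = rho x * sin (th x)].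

Lemma wronskian_derive p q r lam1 lam2 u1 v1 u2 v2 (x : R) :
  planar_solution p q r lam1 u1 v1 -> planar_solution p q r lam2 u2 v2 ->
  0 < x ->
  is_derive x 1 (fun t => u1 t * v2 t - v1 t * u2 t)
    ((lam2 - lam1) * (u1 x * u2 x + v1 x * v2 x)).
Proof.
move=> s1 s2 x0; have [du1 dv1] := s1 x x0; have [du2 dv2] := s2 x x0.
apply: (is_derive_eq (is_deriveB (is_deriveM du1 dv2) (is_deriveM dv1 du2))).
by rewrite /GRing.scale/=; ring.
Qed.

(** The [lam] terms only rotate the solution, so they cancel in the derivative of its squared
    length. *)
Lemma norm_derive p q r lam u v rho th (x : R) :
  planar_solution p q r lam u v -> polar u v rho th -> 0 < x ->
  is_derive x 1 (fun t => u t * u t + v t * v t)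
    (2 * rho x ^+ 2 * qskew (p x) (q x) (r x) (th x)).
Proof.
move=> s pol x0; have [du dv] := s x x0; have [_ eu ev] := pol x x0.
apply: (is_derive_eq (is_deriveD (is_deriveM du du) (is_deriveM dv dv))).
by rewrite /GRing.scale/= /qskew eu ev; ring.
Qed.

(** The quotient is [tan (th - s)], written with [u] and [v] because [th] is not assumed
    differentiable. The formula amounts to [th' = lam - qform]. *)
Lemma tan_derive p q r lam u v rho th s (x : R) :
  planar_solution p q r lam u v -> polar u v rho th -> 0 < x ->
  cos (th x - s) != 0 ->
  is_derive x 1
    (fun t => (v t * cos s - u t * sin s) / (u t * cos s + v t * sin s))
    ((lam - qform (p x) (q x) (r x) (th x)) / cos (th x - s) ^+ 2).
Proof.
move=> sol pol x0 cosN0; have [du dv] := sol x x0.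
have [rho0 eu ev] := pol x x0.
have eden : u x * cos s + v x * sin s = rho x * cos (th x - s).
  by rewrite eu ev cosB; ring.
have rhoN0 : rho x != 0 by rewrite gt_eqF.
have denN0 : u x * cos s + v x * sin s != 0 by rewrite eden mulf_neq0.
have dcos : is_derive x 1 (cst (cos s)) 0 by exact: is_derive_cst.
have dsin : is_derive x 1 (cst (sin s)) 0 by exact: is_derive_cst.
have dden := is_deriveD (is_deriveM du dcos) (is_deriveM dv dsin).
have dnum := is_deriveB (is_deriveM dv dcos) (is_deriveM du dsin).
have dinv := @is_deriveV _ (u * cst (cos s) + v * cst (sin s)) _ _ _ denN0 dden.
apply: (is_derive_eq (is_deriveM dnum dinv)).
rewrite /GRing.scale/=.
have -> : (v * cst (cos s) - u * cst (sin s)) x = rho x * sin (th x - s).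
  by rewrite sinB mulrBr !mulrA -eu -ev.
have -> : (u * cst (cos s) + v * cst (sin s)) x = rho x * cos (th x - s).
  exact: eden.
have ecos : cos (th x) = cos (th x - s) * cos s - sin (th x - s) * sin s.
  by rewrite -cosD subrK.
have esin : sin (th x) = sin (th x - s) * cos s + cos (th x - s) * sin s.
  by rewrite -sinD subrK.
set u' := q x * u x + _; set v' := (lam - p x) * u x - _.
(* By the addition formulas, the numerator left by the quotient rule depends on [th x] alone. *)
transitivity ((v' * cos (th x) - u' * sin (th x)) / (rho x * cos (th x - s) ^+ 2)).
  by rewrite ecos esin; field; apply/andP.
have -> : v' * cos (th x) - u' * sin (th x) =
    rho x * (lam * (cos (th x) ^+ 2 + sin (th x) ^+ 2)
             - qform (p x) (q x) (r x) (th x)).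
  by rewrite /v' /u' eu ev /qform; ring.
by rewrite cos2Dsin2 mulr1; field; apply/andP.
Qed.

(** * Limit of the angle at the singular endpoint 0 *)

Section SingularEndpoint.
Variables (p q r : R -> R) (beta a b c : R).
Hypothesis beta1 : 1 <= beta.
Hypothesis pa : x `^ beta * p x @[x --> 0^'+] --> a.
Hypothesis qb : x `^ beta * q x @[x --> 0^'+] --> b.
Hypothesis rc : x `^ beta * r x @[x --> 0^'+] --> c.
Variables (lam : R) (u v rho th : R -> R) (th0 : R).
Hypothesis sol : planar_solution p q r lam u v.
Hypothesis pol : polar u v rho th.
Hypothesis thth0 : th x @[x --> 0^'+] --> th0.

(** The function [tan (th - th0)] tends to 0 while [x ^ beta] times its derivative tends to
    [- qform a b c th0]. By [cvg_at_right0_deriv_eq0] the latter limit vanishes. *)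
Lemma cvg_angle0_null : qform a b c th0 = 0.
Proof.
have cvgd : th x - th0 @[x --> 0^'+] --> 0.
  by rewrite -[X in _ --> X](subrr th0); apply: cvgB => //; exact: cvg_cst.
have cvgcos : cos (th x - th0) @[x --> 0^'+] --> (1 : R).
  by rewrite -[X in _ --> X]cos0; apply: continuous_cvg cvgd; exact: continuous_cos.
have cvgsin : sin (th x - th0) @[x --> 0^'+] --> (0 : R).
  by rewrite -[X in _ --> X]sin0; apply: continuous_cvg cvgd; exact: continuous_sin.
(* This keeps the tangent away from its poles on some [(0, e)]. *)
have cos_gt0 : \forall x \near 0^'+, 0 < cos (th x - th0).
  exact: cvgr_gt cvgcos _ ltr01.
have [e e0 eP] := at_right0_itv cos_gt0.
apply/eqP; rewrite -oppr_eq0; apply/eqP.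
apply: (@cvg_at_right0_deriv_eq0 _
  (fun t => (v t * cos th0 - u t * sin th0) / (u t * cos th0 + v t * sin th0))
  (fun x => (lam - qform (p x) (q x) (r x) (th x)) / cos (th x - th0) ^+ 2)
  beta 0 _ e beta1 e0).
- move=> x /[dup] /andP[x0 _] /eP cosx.
  by apply: tan_derive pol _ _ => //; rewrite gt_eqF.
- have : sin (th x - th0) / cos (th x - th0) @[x --> 0^'+] --> (0 : R).
    rewrite -[X in _ --> X](mul0r (1^-1)); apply: cvgM => //.
    by apply: cvgV => //; exact: oner_neq0.
  apply: cvg_trans; apply: near_eq_cvg; near=> x.
  have x0 : 0 < x by near: x; exact: nbhs_right_gt.
  have [rho0 -> ->] := pol x0.
  have -> : rho x * sin (th x) * cos th0 - rho x * cos (th x) * sin th0 =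
    rho x * sin (th x - th0) by rewrite sinB; ring.
  have -> : rho x * cos (th x) * cos th0 + rho x * sin (th x) * sin th0 =
    rho x * cos (th x - th0) by rewrite cosB; ring.
  by rewrite -mulf_div divff ?mul1r// gt_eqF.
(* The weight [x ^ beta] enters the coefficients of the form, and [lam * x ^ beta] vanishes in the
   limit since [beta > 0]. *)
- have : (lam * x `^ beta - qform (x `^ beta * p x) (x `^ beta * q x)
      (x `^ beta * r x) (th x)) / cos (th x - th0) ^+ 2
      @[x --> 0^'+] --> (lam * 0 - qform a b c th0) / (1 ^+ 2).
    under eq_fun do rewrite expr2.
    apply: cvgM.
      apply: cvgB; last exact: cvg_qform.
      apply: cvgM; first exact: cvg_cst.
      by apply: powR_cvg0; exact: lt_le_trans beta1.
    by apply: cvgV; [rewrite expr2 mulr1 oner_neq0|exact: cvgM].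
  rewrite mulr0 sub0r expr1n divr1; apply: cvg_trans; apply: near_eq_cvg.
  near=> x; rewrite qformZ; ring.
Unshelve. all: by end_near. Qed.

(** With a negative limit, the squared norm would be strictly decreasing near 0; starting from limit
    0 it would become negative. *)
Lemma cvg_angle0_qskew_ge0 :
  u x @[x --> 0^'+] --> 0 -> v x @[x --> 0^'+] --> 0 -> 0 <= qskew a b c th0.
Proof.
move=> u0 v0; rewrite leNgt; apply/negP => sk0.
have sk_lt0 : \forall x \near 0^'+, qskew (x `^ beta * p x) (x `^ beta * q x)
    (x `^ beta * r x) (th x) < 0.
  exact: cvgr_lt (cvg_qskew _ pa qb rc thth0) _ sk0.
have [e e0 eP] := at_right0_itv sk_lt0.
pose N := (fun t => u t * u t + v t * v t) : R -> R.
have N0 : (- N) t @[t --> 0^'+] --> 0.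
  rewrite -[X in _ --> X]oppr0; apply: cvgN.
  have : N x @[x --> 0^'+] --> (0 * 0 + 0 * 0 : R) by apply: cvgD; exact: cvgM.
  by rewrite mulr0 addr0.
have e20 : 0 < e / 2 by lra.
have : 0 < (- N) (e / 2).
  apply: (@is_derive_gt0_cvg0_gt0 _ (- N)
    (fun x => - (2 * rho x ^+ 2 * qskew (p x) (q x) (r x) (th x))) e _ _ N0).
    move=> x /[dup] /andP[x0 _] /eP; rewrite qskewZ => skx; split.
      exact: is_deriveN (norm_derive sol pol x0).
    have [rho0 _ _] := pol x0.
    rewrite oppr_gt0 pmulr_rlt0 ?mulr_gt0 ?exprn_gt0//.
    by move: skx; rewrite pmulr_rlt0 ?powR_gt0.
  by lra.
apply/negP; rewrite -leNgt oppr_le0 /N.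
by rewrite addr_ge0// -expr2 sqr_ge0.
Qed.

End SingularEndpoint.

(** * Comparison of the angles for two parameters *)

Lemma polar_wronskian u1 v1 rho1 th1 u2 v2 rho2 th2 (x : R) :
  polar u1 v1 rho1 th1 -> polar u2 v2 rho2 th2 -> 0 < x ->
  u1 x * v2 x - v1 x * u2 x = rho1 x * rho2 x * sin (th2 x - th1 x) /\
  u1 x * u2 x + v1 x * v2 x = rho1 x * rho2 x * cos (th2 x - th1 x).
Proof.
move=> pol1 pol2 x0; have [_ -> ->] := pol1 x x0; have [_ -> ->] := pol2 x x0.
by rewrite sinB cosB; split; ring.
Qed.

(** The zero is the infimum [s] of the points where [f <= 0]. By continuity [f s > 0] would keep
    such points away from [s], and [f s < 0] would contradict positivity just before [s]. *)
Lemma first_zero (f : R -> R) (x y : R) :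
  x <= y -> {in `[x, y]%R, continuous f} -> 0 < f x -> f y <= 0 ->
  exists2 s, x < s <= y & f s = 0 /\ forall t, x <= t < s -> 0 < f t.
Proof.
move=> xy cf fx fy.
pose Z := [set t | t \in `[x, y]%R /\ f t <= 0].
have Zy : Z y by split => //; rewrite in_itv/= xy lexx.
have Zlb : lbound Z x by move=> t [/itvP ->].
have hZ : has_inf Z by split; [exists y|exists x].
pose s := inf Z.
have xs : x <= s by apply: lb_le_inf => //; exists y.
have sy : s <= y by apply: ge_inf => //; exists x.
have before t : x <= t < s -> 0 < f t.
  move=> /andP[xt ts]; rewrite ltNge; apply/negP => ft0.
  have : s <= t.
    by apply: ge_inf; [exists x|split => //; rewrite in_itv/= xt (le_trans (ltW ts))].
  by rewrite leNgt ts.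
have cfs : {for s, continuous f} by apply: cf; rewrite in_itv/= xs sy.
have fs_le : f s <= 0.
  rewrite leNgt; apply/negP => fs.
  have /nbhs_ballP[e /= e0 eP] : \forall t \near s, 0 < f t by exact: cvgr_gt cfs _ fs.
  have [t Zt ts] := inf_adherent e0 hZ.
  have st : s <= t by apply: ge_inf => //; exists x.
  have : 0 < f t.
    by apply: eP; rewrite /ball/= distrC ger0_norm ?subr_ge0// ltrBlDl.
  by rewrite ltNge; have [_ ->] := Zt.
have xs' : x < s.
  by rewrite lt_neqAle xs andbT; apply/eqP => E; move: fs_le; rewrite -E leNgt fx.
exists s; first by rewrite xs' sy.
split => //; apply/eqP; rewrite eq_le fs_le /=.
rewrite leNgt; apply/negP => fs.
have near_lt : \forall t \near s, f t < 0 by exact: cvgr_lt cfs _ fs.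
have near_lt' : \forall t \near s^'-, f t < 0 by exact: cvg_at_left_filter near_lt.
near s^'- => t.
have : 0 < f t by apply: before; apply/andP; split; near: t;
  [exact: nbhs_left_ge|exact: nbhs_left_lt].
by rewrite ltNge ltW//; near: t.
Unshelve. all: by end_near. Qed.

(** The Wronskian sees the difference [D] of the angles only through its sine and cosine. The
    argument therefore stays where [D] is smaller than [pi / 2] in absolute value: near 0, then near
    a first zero of [D]. *)
Lemma angle_lt p q r lam1 u1 v1 rho1 th1 lam2 u2 v2 rho2 th2 :
  lam1 < lam2 ->
  planar_solution p q r lam1 u1 v1 -> polar u1 v1 rho1 th1 ->
  planar_solution p q r lam2 u2 v2 -> polar u2 v2 rho2 th2 ->
  u1 t * v2 t - v1 t * u2 t @[t --> 0^'+] --> 0 ->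
  th2 t - th1 t @[t --> 0^'+] --> 0 ->
  {in `]0, +oo[%R, continuous (fun t => th2 t - th1 t)} ->
  forall x : R, 0 < x -> th1 x < th2 x.
Proof.
move=> lam12 sol1 pol1 sol2 pol2 W0 D0 cD.
pose W t := u1 t * v2 t - v1 t * u2 t; pose D t := th2 t - th1 t.
pose dW t := (lam2 - lam1) * (u1 t * u2 t + v1 t * v2 t).
have pi20 : 0 < pi / 2 :> R by rewrite divr_gt0 ?pi_gt0.
have rho_gt0 t : 0 < t -> 0 < rho1 t * rho2 t.
  by move=> t0; have [? _ _] := pol1 t t0; have [? _ _] := pol2 t t0; rewrite mulr_gt0.
have dW_gt0 t : 0 < t -> `|D t| < pi / 2 -> is_derive t 1 W (dW t) /\ 0 < dW t.
  move=> t0; rewrite ltr_norml => Dt; split; first exact: wronskian_derive sol1 sol2 t0.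
  have [_] := polar_wronskian pol1 pol2 t0; rewrite /dW => ->.
  by rewrite mulr_gt0 ?subr_gt0// mulr_gt0 ?rho_gt0// cos_gt0_pihalf.
have D_gt0 t : 0 < t -> `|D t| < pi / 2 -> 0 < W t -> 0 < D t.
  move=> t0 /ltr_normlP[Dt _]; rewrite /W (polar_wronskian pol1 pol2 t0).1.
  rewrite pmulr_rgt0 ?rho_gt0// => sin0; rewrite ltNge; apply/negP => Dt0.
  have : 0 <= sin (- D t) by apply: sin_ge0_pi; have := pi_ge0 R; lra.
  by rewrite sinN oppr_ge0 leNgt sin0.
have [e e0 eP] : exists2 e : R, 0 < e & forall t, 0 < t < e -> `|D t| < pi / 2.
  by apply: at_right0_itv; exact: (cvgr0_norm_lt D D0).
have Dnear t : 0 < t < e -> 0 < D t.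
  move=> /[dup] /andP[t0 te] /eP Dt; apply: D_gt0 => //.
  apply: (@is_derive_gt0_cvg0_gt0 _ W dW e) => //; last by rewrite t0.
  by move=> s /[dup] /andP[s0 _] /eP; exact: dW_gt0.
move=> x x0; rewrite -subr_gt0 ltNge; apply/negP => Dx.
have [xe|ex] := ltP x e.
  by have := Dnear x; rewrite x0 xe => /(_ isT); rewrite ltNge Dx.
(* The search for a zero starts at [e / 2], where [D] is already known to be positive. *)
have y0 : 0 < e / 2 by lra.
have yx : e / 2 <= x by lra.
have [s /andP[ys sx] [Ds before]] : exists2 s, e / 2 < s <= x &
    D s = 0 /\ forall t, e / 2 <= t < s -> 0 < D t.
  apply: first_zero => //.
    by move=> t /itvP tyx; apply: cD; rewrite in_itv/= andbT (lt_le_trans y0)// tyx.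
  by apply: Dnear; lra.
have s0 : 0 < s by exact: lt_trans ys.
have cDs : {for s, continuous D} by apply: cD; rewrite in_itv/= s0.
have : \forall t \near s, `|D t| < pi / 2.
  have Ds0 : D t @[t --> s] --> 0 by rewrite -[X in _ --> X]Ds; exact: cDs.
  exact: (cvgr0_norm_lt D Ds0).
move=> /nbhs_ballP[d /= d0 dP].
(* On [(l, s + d)] the Wronskian increases; [l >= e / 2] also ensures [D > 0] between [l] and
   [s]. *)
pose l := Num.max (e / 2) (s - d).
have ls : l < s by rewrite gt_max ys; lra.
have lP t : l < t < s + d -> 0 < t /\ `|D t| < pi / 2.
  rewrite gt_max -andbA => /and3P[yt st ts]; split; first exact: lt_trans yt.
  by apply: dP; rewrite /ball/= ltr_norml; apply/andP; split; lra.
pose t := (l + s) / 2.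
have lt : l < t by rewrite /t; lra.
have ts : t < s by rewrite /t; lra.
have [t0 Dt] : 0 < t /\ `|D t| < pi / 2 by apply: lP; rewrite lt /=; lra.
(* Here [W s = 0], so [W t < 0], although [0 < D t < pi / 2] gives [sin (D t) >= 0]. *)
have : W t < W s.
  apply: (@is_derive_gt0_lt _ W dW l (s + d)) => //; last by lra.
  by move=> w /lP[w0 Dw]; exact: dW_gt0.
rewrite /W (polar_wronskian pol1 pol2 s0).1 -/(D s) Ds sin0 mulr0.
rewrite (polar_wronskian pol1 pol2 t0).1 pmulr_rlt0 ?rho_gt0// -/(D t).
have Dt0 : 0 < D t.
  by apply: before; rewrite ts andbT ltW// (le_lt_trans _ lt)// le_max lexx.
rewrite ltNge => /negP; apply; apply: sin_ge0_pi; rewrite ltW//=.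
move: Dt; rewrite ltr_norml => /andP[_]; have := pi_ge0 R; lra.
Qed.

End PlanarSystem.

(** * Monotonicity of the normalized angle for the matrix equation *)

Lemma is_solution_planar (R : realType) (P : R -> 'M[R]_2) (lambda : R)
    (z : R -> 'cV[R]_2) :
  (forall x : R, 0 < x -> (P x)^T = P x) -> is_solution P lambda z ->
  planar_solution (fun x => P x 0 0) (fun x => P x 0 1) (fun x => P x 1 1)
    lambda (fun x => z x 0 0) (fun x => z x 1 0).
Proof. by move=> Psym sol x x0; apply: is_solution_derive => //; exact: Psym. Qed.

Lemma det2 (K : comNzRingType) (A : 'M[K]_2) :
  \det A = A 0 0 * A 1 1 - A 0 1 * A 1 0.
Proof.
rewrite (expand_det_row _ 0) !big_ord_recl big_ord0 /cofactor !det_mx11 !mxE /=.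
have -> : ord0 = 0 :> 'I_2 by apply/val_inj.
have -> : lift 0 ord0 = 1 :> 'I_2 by apply/val_inj.
have -> : lift 1 0 = 0 :> 'I_2 by apply/val_inj.
by rewrite expr0 expr1; ring.
Qed.

Lemma is_theta_lt (R : realType) (P : R -> 'M[R]_2) (lam1 lam2 : R)
    (th1 th2 : R -> R) :
  (forall x : R, 0 < x -> (P x)^T = P x) -> cond_zero P ->
  lam1 < lam2 -> is_theta P lam1 th1 -> is_theta P lam2 th2 ->
  forall x : R, 0 < x -> th1 x < th2 x.
Proof.
move=> Psym [beta [M [qq [[beta1 Msym _] PM _ det1 detgt]]]] lam12.
move=> [[z1 [sol1 _ z10] [c1 [rho1 pol1]]] [t1 t1b tht1]].
move=> [[z2 [sol2 _ z20] [c2 [rho2 pol2]]] [t2 t2b tht2]].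
have detM : \det M < 0.
  have : beta = 1 \/ 1 < beta by move: beta1; rewrite le_eqVlt => /predU1P[]; auto.
  by case=> [/det1 ?|/detgt//]; lra.
have M10 : M 1 0 = M 0 1 by rewrite -{1}Msym mxE.
have cz z i : z x @[x --> 0^'+] --> (0 : 'cV[R]_2) ->
    z x i 0 @[x --> (0 : R)^'+] --> (0 : R).
  move=> z0; have : z x i 0 @[x --> 0^'+] --> (0 : 'cV[R]_2) i 0.
    exact: (cvg_comp _ _ z0 (@coord_continuous R _ _ i 0 _)).
  by rewrite mxE.
have cP i j : x `^ beta * P x i j @[x --> 0^'+] --> M i j.
  have : (x `^ beta *: P x) i j @[x --> 0^'+] --> M i j.
    exact: (cvg_comp _ _ PM (@coord_continuous R _ _ i j _)).
  by under eq_fun do rewrite mxE.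
have {}sol1 := is_solution_planar Psym sol1.
have {}sol2 := is_solution_planar Psym sol2.
have null1 := cvg_angle0_null beta1 (cP 0 0) (cP 0 1) (cP 1 1) sol1 pol1 tht1.
have null2 := cvg_angle0_null beta1 (cP 0 0) (cP 0 1) (cP 1 1) sol2 pol2 tht2.
have sk1 := cvg_angle0_qskew_ge0 (cP 0 0) (cP 0 1) (cP 1 1) sol1 pol1 tht1
  (cz _ _ z10) (cz _ _ z10).
have sk2 := cvg_angle0_qskew_ge0 (cP 0 0) (cP 0 1) (cP 1 1) sol2 pol2 tht2
  (cz _ _ z20) (cz _ _ z20).
(* At a null direction the square of [qskew] is [- \det M], which is positive. *)
have skN0 : qskew (M 0 0) (M 0 1) (M 1 1) t1 != 0.
  rewrite -sqrf_eq0 qskew_sqr_null// gt_eqF//.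
  move: detM; rewrite det2 M10; lra.
(* Both skew values are nonnegative and the first is nonzero, so their sum is nonzero and
   [sin (t2 - t1) = 0]. Since both angles lie in [[0, pi)], they coincide. *)
have t12 : t1 = t2.
  have /eqP := qskew_null_sin null1 null2; rewrite mulf_eq0 paddr_eq0//.
  rewrite (negPf skN0)/= => /eqP sin0.
  move: t1b t2b => /andP[? ?] /andP[? ?].
  have [t12|t21|//] := ltgtP t1 t2.
    have : 0 < sin (t2 - t1) by apply: sin_gt0_pi; lra.
    by rewrite sin0 ltxx.
  have : 0 < sin (t1 - t2) by apply: sin_gt0_pi; lra.
  by rewrite -opprB sinN sin0 oppr0 ltxx.
apply: (angle_lt lam12 sol1 pol1 sol2 pol2).
- have : z1 t 0 0 * z2 t 1 0 - z1 t 1 0 * z2 t 0 0 @[t --> 0^'+] --> (0 * 0 - 0 * 0 : R).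
    by apply: cvgB; apply: cvgM; exact: cz.
  by rewrite mulr0 subrr.
- by rewrite -[X in _ --> X](subrr t2) -{2}t12; exact: cvgB.
- by move=> x x0; apply: cvgB; [exact: c2|exact: c1].
Qed.

(** * Passage to the limit at infinity, then in the parameter *)

Unset Implicit Arguments.

Theorem lemma3p7 (R : realType) (mum mup : R) (P : R -> 'M[R]_2)
  (theta : R -> R -> R) (nu : R -> R) (thetap : R)
  (hmu : mum < mup)
  (hP : classP mum mup P)
  (htheta : forall lambda : R, mum < lambda <= mup ->
     is_theta P lambda (fun x => theta x lambda))
  (hnu : forall lambda : R, mum < lambda < mup ->
     theta x lambda @[x --> +oo] --> nu lambda)
  (hthetap : theta x mup @[x --> +oo] --> thetap) :
  exists2 l : \bar R,
    (nu lambda)%:E @[lambda --> mup^'-] --> l & (l < +oo)%E.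
Proof.
case: hP => _ Psym _ P0.
(* The endpoint [l2 = mup] is included: it bounds [nu] by [thetap], while [l2 < mup] gives
   monotonicity of [nu]. *)
have theta_lt l1 l2 : mum < l1 -> l1 < l2 -> l2 <= mup ->
    \forall x \near +oo, theta x l1 <= theta x l2.
  move=> m1 l12 l2p; near=> x; apply: ltW.
  apply: (is_theta_lt Psym P0 l12 (htheta _ _) (htheta _ _)).
  - by rewrite m1 (le_trans (ltW l12)).
  - by rewrite l2p (lt_trans m1).
  - by near: x; exact: nbhs_pinfty_gt.
have nu_le l1 l2 : mum < l1 -> l1 <= l2 -> l2 < mup -> nu l1 <= nu l2.
  move=> m1; rewrite le_eqVlt => /predU1P[->//|l12 l2p].
  apply: ler_cvg_to (hnu l1 _) (hnu l2 _) (theta_lt _ _ m1 l12 (ltW l2p)).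
  - by rewrite m1 (lt_trans l12).
  - by rewrite l2p (lt_trans m1).
have nu_ub l : mum < l < mup -> nu l <= thetap.
  move=> /[dup] lb /andP[ml lp].
  exact: ler_cvg_to (hnu l lb) hthetap (theta_lt _ _ ml lp (lexx _)).
(* A nondecreasing function bounded above has a real left limit, so the extended limit is finite. *)
have /cvg_ex[l nul] : cvg (nu lambda @[lambda --> mup^'-]).
  apply: nondecreasing_at_left_is_cvgr; near=> x.
  (* Taking [x] at least [mum] keeps []x, mup[] inside the range where [nu] is controlled. *)
  - have mx : mum <= x by near: x; exact: nbhs_left_ge.
    move=> l1 l2; rewrite !in_itv/= => /andP[x1 _] /andP[_ l2p] l12.
    by apply: nu_le => //; exact: le_lt_trans x1.
  - have mx : mum <= x by near: x; exact: nbhs_left_ge.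
    exists thetap => _ /= [y + <-]; rewrite in_itv/= => /andP[xy yp].
    by apply: nu_ub; rewrite yp (le_lt_trans mx).
exists l%:E; last exact: ltry.
by apply: cvg_EFin => //; exact: nearW.
Unshelve. all: by end_near. Qed.
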